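(* Let $(\mathcal{X},P)$ be a finite irreducible Markov chain with non-negative Bakry--Émery curvature, i.e. $\mathrm{BE}(\mathcal{X},P)\ge0$. Let $\varepsilon\in(0,1/2)$. Assume that $(k_{(\mathcal{X},P)}+3)\,t_{\mathrm{mix}}(1-\varepsilon)\ge\mathrm{diam}(\mathcal{X})$. Then $$t_{\mathrm{mix}}(\varepsilon)-t_{\mathrm{mix}}(1-\varepsilon)\le\frac{2t_{\mathrm{rel}}}{\varepsilon^2}\left(1+3k_{(\mathcal{X},P)}^2\,(\log\Delta(P)+4)\sqrt{t_{\mathrm{mix}}(1-\varepsilon)}\right).$$
   Context: A finite irreducible Markov chain $(\mathcal{X},P)$ consists of a finite set $\mathcal{X}$ with $|\mathcal{X}|\ge2$ and an irreducible stochastic matrix $P$ on $\mathcal{X}$ (no symmetry of the support assumed), with stationary distribution $\pi$. $\mathscr{P}_t(x,y)=e^{-t}\sum_{m\ge0}\frac{t^m}{m!}P^m(x,y)$; $\|\mu_1-\mu_2\|_{\mathrm{TV}}=\frac12\sum_x|\mu_1(x)-\mu_2(x)|$; $t_{\mathrm{mix}}(\varepsilon)=\inf\{t\ge0:\max_x\|\mathscr{P}_t(x,\cdot)-\pi\|_{\mathrm{TV}}\le\varepsilon\}$ for $0<\varepsilon<1$. $\Gamma(f,g)(x)=\frac12\sum_y(f(x)-f(y))(g(x)-g(y))P(x,y)$, $\Gamma(f)=\Gamma(f,f)$, $\mathcal{E}(f)=\sum_x\Gamma(f)(x)\pi(x)$; $t_{\mathrm{rel}}=\sup\{\mathrm{Var}_\pi(f)/\mathcal{E}(f):f:\mathcal{X}\to\mathbb{R},\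 \mathcal{E}(f)>0\}$, where $\mathrm{Var}_\pi$ is the variance under $\pi$. $\mathcal{L}f(x)=\sum_yP(x,y)(f(y)-f(x))$; $\mathrm{BE}(\mathcal{X},P)$ is the supremum of all $\kappa$ such that $\frac12\mathcal{L}\Gamma(f)(x)\ge\Gamma(f,\mathcal{L}f)(x)+\kappa\Gamma(f)(x)$ for all $f:\mathcal{X}\to\mathbb{R}$, $x\in\mathcal{X}$. $d_P(x\to y)=\min\{k\in\mathbb{N}_0:P^k(x,y)>0\}$ (with $P^0=I$); $k_{(\mathcal{X},P)}=\max\{d_P(y\to x):d_P(x\to y)=1\}$; $\mathrm{diam}(\mathcal{X})=\max\{d_P(x\to y):x,y\in\mathcal{X}\}$; $\Delta(P)=\max\{1/P(x,y):P(x,y)>0,\ x\ne y\}$. *)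

(* Defs.v *)
From HB Require Import structures.
From mathcomp Require Import all_boot all_order all_algebra.
From mathcomp Require Import boolp classical_sets functions reals.
From mathcomp Require Import constructive_ereal ereal topology normedtype.
From mathcomp Require Import sequences exp.

Set Implicit Arguments.
Unset Strict Implicit.
Unset Printing Implicit Defensive.

Import Order.TTheory GRing.Theory Num.Theory.
Import numFieldNormedType.Exports.

Local Open Scope classical_set_scope.
Local Open Scope ring_scope.

Fixpoint kernel_pow (R : realType) (X : finType) (P : X -> X -> R) (m : nat)
    : X -> X -> R :=
  if m is m'.+1 then fun x y => \sum_z P x z * kernel_pow P m' z y
  else fun x y => (x == y)%:R.

Record irreducible_chain (R : realType) (X : finType) := IrreducibleChain {
  transition :> X -> X -> R;
  chain_card_ge2 : (2 <= #|X|)%N;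
  transition_ge0 : forall x y, 0 <= transition x y;
  transition_sum1 : forall x, \sum_y transition x y = 1;
  chain_irreducible : forall x y, exists m, 0 < kernel_pow transition m x y
}.

Definition is_stationary (R : realType) (X : finType) (P : X -> X -> R)
    (pi : X -> R) : Prop :=
  [/\ forall x, 0 <= pi x, \sum_x pi x = 1
    & forall y, \sum_x pi x * P x y = pi y].

Definition heat (R : realType) (X : finType) (P : X -> X -> R) (t : R)
    (x y : X) : R :=
  expR (- t) * limn (series (fun m => t ^+ m / m`!%:R * kernel_pow P m x y)).

Definition tv_dist (R : realType) (X : finType) (mu1 mu2 : X -> R) : R :=
  2^-1 * \sum_x `|mu1 x - mu2 x|.

(* Total variation distances are nonnegative, so the default value 0 of the
   maximum is harmless. By convergence to equilibrium the set is nonempty for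
   0 < eps, so the real infimum is the intended one. *)
Definition t_mix (R : realType) (X : finType) (P : X -> X -> R) (pi : X -> R)
    (eps : R) : R :=
  inf [set t | 0 <= t /\
    \big[Num.max/0]_(x : X) tv_dist (heat P t x) pi <= eps].

Definition carre_du_champ (R : realType) (X : finType) (P : X -> X -> R)
    (f g : X -> R) (x : X) : R :=
  2^-1 * \sum_y (f x - f y) * (g x - g y) * P x y.

Definition Gamma (R : realType) (X : finType) (P : X -> X -> R)
    (f : X -> R) : X -> R := carre_du_champ P f f.

Definition dirichlet (R : realType) (X : finType) (P : X -> X -> R)
    (pi f : X -> R) : R :=
  \sum_x Gamma P f x * pi x.

Definition mean (R : realType) (X : finType) (pi f : X -> R) : R :=
  \sum_x f x * pi x.

Definition variance (R : realType) (X : finType) (pi f : X -> R) : R :=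
  mean pi (fun x => (f x - mean pi f) ^+ 2).

(* For an irreducible chain on at least two states, the set is nonempty and
   bounded (spectral gap), so the real supremum is the intended one. *)
Definition t_rel (R : realType) (X : finType) (P : X -> X -> R)
    (pi : X -> R) : R :=
  sup [set variance pi f / dirichlet P pi f
      | f in [set f : X -> R | 0 < dirichlet P pi f]].

Definition generator (R : realType) (X : finType) (P : X -> X -> R)
    (f : X -> R) (x : X) : R :=
  \sum_y P x y * (f y - f x).

(* The supremum is taken in the extended reals, so that it needs neither
   nonemptiness nor boundedness of the set of admissible lower bounds. *)
Definition BE (R : realType) (X : finType) (P : X -> X -> R) : \bar R :=
  ereal_sup [set kappa%:E | kappa in [set kappa : R |
    forall (f : X -> R) (x : X),
      carre_du_champ P f (generator P f) x + kappa * Gamma P f x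
        <= 2^-1 * generator P (Gamma P f) x]].

Section Distances.
Variables (R : realType) (X : finType) (C : irreducible_chain R X).

Definition chain_dist (x y : X) : nat := ex_minn (chain_irreducible C x y).

Definition chain_k : nat :=
  \max_(p : X * X | chain_dist p.1 p.2 == 1%N) chain_dist p.2 p.1.

Definition chain_diam : nat := \max_(p : X * X) chain_dist p.1 p.2.

(* The range is nonempty and all terms are positive, so the default value 0
   never matters. *)
Definition chain_Delta : R :=
  \big[Num.max/0]_(p : X * X | (p.1 != p.2) && (0 < C p.1 p.2)) (C p.1 p.2)^-1.

End Distances.

(* Main.v *)
(* Write [h = ln (P_t(o, .) / pi)] for [t] slightly above [t_mix (1 - eps)].

   Nonnegative curvature gives [Gamma (P_s f) <= P_s (Gamma f)], hence the
   local Poincare inequality [P_t (f ^ 2) - (P_t f) ^ 2 <= 2 t P_t (Gamma f)].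
   Since [h] varies by at most [c = 3 k ^ 2 (ln Delta + 4)] along an edge, its
   variance under [P_t(o, .)] is at most [c ^ 2 t].

   The gradient bound needs no curvature: conditionally on [X_t = z], the
   number of jumps before time [t] is of order at most
   [t + ln (1 / P_t(o, z))], and since [diam <= (k + 3) t] the logarithm is
   [O(t (k + 3) (ln Delta + ln (k + 3)))]; adding one jump to the trajectories
   ending at [z] compares [P_t(o, z)] with [P_t(o, z')] for a neighbour [z'],
   and the backward comparison goes along a path of at most [k] edges.

   A bounded variance of [h] combined with [TV(P_t(o, .), pi) <= 1 - eps]
   bounds [h] from above outside a set of [P_t(o, .)]-mass [eps / 2] (a reverse
   Pinsker inequality), so that the density may be truncated; the truncated
   density is square integrable and relaxes to equilibrium at rate
   [1 / t_rel]. *)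

Require Import Defs.
From HB Require Import structures.
From mathcomp Require Import all_boot all_order all_algebra.
From mathcomp Require Import boolp classical_sets functions reals.
From mathcomp Require Import constructive_ereal ereal topology normedtype.
From mathcomp Require Import sequences exp derive realfun.
From mathcomp Require Import ring lra.

Set Implicit Arguments.
Unset Strict Implicit.
Unset Printing Implicit Defensive.

Import Order.TTheory GRing.Theory Num.Theory.
Import numFieldNormedType.Exports.

Local Open Scope ring_scope.
Local Open Scope classical_set_scope.

(** * Exponential generating functions of bounded sequences *)

Section exponential_generating_function.
Context {R : realType}.
Implicit Types (a : nat -> R) (M t : R).

Definition egf a t : R := limn (series (fun m => t ^+ m / m`!%:R * a m)).

Lemma egf_pseries a t :
  series (fun m => t ^+ m / m`!%:R * a m) = pseries (fun m => a m / m`!%:R) t.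
Proof. by congr series; apply/funext => m; rewrite mulrC mulrA mulrAC. Qed.

Lemma is_cvg_egf a M t : (forall m, `|a m| <= M) ->
  cvgn (series (fun m => t ^+ m / m`!%:R * a m)).
Proof.
move=> aM; apply: normed_cvg.
apply: (@series_le_cvg _ _ (fun m => exp_coeff `|t| m * M)).
- by move=> m; rewrite normr_ge0.
- by move=> m; rewrite mulr_ge0 ?exp_coeff_ge0 ?normr_ge0 ?(le_trans _ (aM 0%N)).
- move=> m; rewrite /exp_coeff /= normrM normrM normrX normfV [`|_%:R|]ger0_norm//.
  by rewrite ler_wpM2l// mulr_ge0// exprn_ge0.
have -> : (fun m => exp_coeff `|t| m * M) = M *: (exp_coeff `|t| : nat -> R).
  by apply/funext => m; rewrite /= mulrC.
exact/is_cvg_seriesZ/is_cvg_series_exp_coeff.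
Qed.

Lemma pseries_diffs_egf a :
  pseries_diffs (fun m => a m / m`!%:R) = fun m => a m.+1 / m`!%:R.
Proof.
apply/funext => m; rewrite /pseries_diffs factS natrM.
have : (m.+1%:R != 0 :> R) by rewrite pnatr_eq0.
have : (m`!%:R != 0 :> R) by rewrite pnatr_eq0 -lt0n fact_gt0.
by move=> *; field; apply/andP.
Qed.

Lemma is_derive_egf a M t : (forall m, `|a m| <= M) ->
  is_derive t 1 (egf a) (egf (a \o S) t).
Proof.
move=> aM.
have -> : egf a = fun t => limn (pseries (fun m => a m / m`!%:R) t).
  by apply/funext => s; rewrite /egf egf_pseries.
have -> : egf (a \o S) t =
    limn (pseries (pseries_diffs (fun m => a m / m`!%:R)) t).
  by rewrite /egf egf_pseries pseries_diffs_egf.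
(* Termwise differentiation needs a point beyond [|t|] at which the series and its first two formal
   derivatives converge; boundedness of [a] allows any point. *)
apply: (@pseries_snd_diffs _ _ (`|t| + 1)).
- by rewrite -egf_pseries; apply: is_cvg_egf aM.
- rewrite pseries_diffs_egf -(egf_pseries (a \o S)).
  by apply: (@is_cvg_egf _ M) => m; exact: aM.
- rewrite pseries_diffs_egf (pseries_diffs_egf (a \o S)).
  rewrite -(egf_pseries (a \o S \o S)).
  by apply: (@is_cvg_egf _ M) => m; exact: aM.
by rewrite [ltRHS]ger0_norm// ltrDl.
Qed.

Lemma egf_sum (I : finType) (a : I -> nat -> R) (c : I -> R) M t :
  (forall i m, `|a i m| <= M) ->
  egf (fun m => \sum_i c i * a i m) t = \sum_i c i * egf (a i) t.
Proof.
move=> aM; apply: cvg_lim => //.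
rewrite (_ : series _ =
    fun n => \sum_i c i * series (fun m => t ^+ m / m`!%:R * a i m) n).
  apply: cvg_big => [|i _]; first exact: add_continuous.
  by apply: cvgMl_tmp; exact: is_cvg_egf (aM i).
apply/funext => n; rewrite /series /=.
under [RHS]eq_bigr do rewrite mulr_sumr.
rewrite exchange_big /=; apply: eq_bigr => m _.
by rewrite mulr_sumr; apply: eq_bigr => i _; rewrite mulrCA.
Qed.

Lemma egf0 a M : (forall m, `|a m| <= M) -> egf a 0 = a 0%N.
Proof.
move=> aM; apply: lim_near_cst => //; near=> m.
rewrite -[m]prednK; last by near: m; exact: nbhs_infty_gt.
rewrite /series /= big_nat_recl//= big1 ?addr0 ?expr0 ?divr1 ?mul1r// => i _.
by rewrite exprS !mul0r.
Unshelve. all: by end_near. Qed.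

Lemma egf_cst t : egf (fun=> 1) t = expR t.
Proof.
by rewrite /egf /expR; congr (limn (series _)); apply/funext => m; rewrite mulr1.
Qed.

Lemma le_egf a M t n : (forall m, `|a m| <= M) -> (forall m, 0 <= a m) ->
  0 <= t -> t ^+ n / n`!%:R * a n <= egf a t.
Proof.
move=> aM a0 t0; have u0 m : 0 <= t ^+ m / m`!%:R * a m.
  by rewrite mulr_ge0// mulr_ge0 ?exprn_ge0.
apply: le_trans (_ : series (fun m => t ^+ m / m`!%:R * a m) n.+1 <= _).
  by rewrite /series /= big_nat_recr//= lerDr sumr_ge0.
apply: nondecreasing_cvgn_le; last exact: is_cvg_egf aM.
by apply: nondecreasing_series => i _ _; exact: u0.
Qed.

Lemma egf_ge0 a M t : (forall m, `|a m| <= M) -> (forall m, 0 <= a m) ->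
  0 <= t -> 0 <= egf a t.
Proof.
move=> aM a0 t0; apply: le_trans (@le_egf _ _ _ 0%N aM a0 t0).
by rewrite mulr_ge0// mulr_ge0 ?exprn_ge0.
Qed.

End exponential_generating_function.

(** * Calculus of real derivatives *)

Section real_derivatives.
Context {R : realType}.
Implicit Types (f g : R -> R) (x : R).

(* [is_derive_eq] without type class resolution on the first premise. *)
Lemma eq_is_derive f x df df' : is_derive x 1 f df -> df = df' ->
  is_derive x 1 f df'.
Proof. by move=> ? <-. Qed.

Lemma is_derive_mulr f g x df dg : is_derive x 1 f df -> is_derive x 1 g dg ->
  is_derive x 1 (fun s => f s * g s) (df * g x + f x * dg).
Proof.
move=> hf hg; have := @is_deriveM _ _ f g x 1 df dg hf hg.
by rewrite addrC /GRing.scale /= [g x * _]mulrC.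
Qed.

Lemma is_derive_mulrc f x df c : is_derive x 1 f df ->
  is_derive x 1 (fun s => f s * c) (df * c).
Proof.
move=> hf; apply: (eq_is_derive (is_derive_mulr hf (is_derive_cst c x 1))).
by rewrite mulr0 addr0.
Qed.

Lemma is_derive_subr f g x df dg : is_derive x 1 f df -> is_derive x 1 g dg ->
  is_derive x 1 (fun s => f s - g s) (df - dg).
Proof. by move=> hf hg; exact: (@is_deriveB _ _ _ f g). Qed.

Lemma is_derive_oppr f x df : is_derive x 1 f df ->
  is_derive x 1 (fun s => - f s) (- df).
Proof. by move=> hf; exact: (@is_deriveN _ _ _ f). Qed.

Lemma is_derive_sumr (I : finType) (f df : I -> R -> R) x :
  (forall i, is_derive x 1 (f i) (df i x)) ->
  is_derive x 1 (fun s => \sum_i f i s) (\sum_i df i x).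
Proof.
move=> hf; elim: (index_enum I) => [|i r IHr].
  rewrite big_nil (_ : (fun _ => _) = cst 0); first exact: is_derive_cst.
  by apply/funext => s; rewrite big_nil.
rewrite big_cons (_ : (fun _ => _) = f i + (fun s => \sum_(j <- r) f j s)).
  exact: is_deriveD.
by apply/funext => s; rewrite big_cons.
Qed.

Lemma is_derive_revr f x (T : R) df : is_derive (T - x) 1 f df ->
  is_derive x 1 (fun s => f (T - s)) (- df).
Proof.
move=> hf; have hT : is_derive x 1 (fun s => T - s) (-1 : R).
  rewrite -[X in is_derive _ _ _ X]sub0r.
  exact: (@is_deriveB _ _ _ (cst T) id).
have := @is_derive1_comp _ f (fun s => T - s) x _ _ hf hT.
by rewrite mulrN1.
Qed.

Lemma is_derive_continuous f x df : is_derive x 1 f df -> {for x, continuous f}.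
Proof. by move=> [h _]; exact/differentiable_continuous/derivable1_diffP. Qed.

(** Mean value theorem. The semigroup identities and inequalities below apply it to a path
    interpolating between their two sides. *)
Lemma nondecreasing_is_derive f df (a b : R) : a <= b ->
  (forall x, a <= x <= b -> is_derive x 1 f (df x)) ->
  (forall x, a <= x <= b -> 0 <= df x) -> f a <= f b.
Proof.
move=> ab hf df0; have h x : x \in `]a, b[%R -> a <= x <= b.
  by rewrite in_itv /= => /andP[/ltW -> /ltW ->].
have [||x] := @MVT_segment _ f df a b ab; first by move=> x /h /hf.
  apply: continuous_in_subspaceT => x; rewrite inE /= in_itv /= => /hf.
  exact: is_derive_continuous.
rewrite in_itv /= => /df0 dfx e.
by rewrite -subr_ge0 e mulr_ge0// subr_ge0.
Qed.

End real_derivatives.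

(** * The heat kernel and its semigroup *)

Section heat_semigroup.
Context {R : realType} {X : finType} (P : X -> X -> R).
Hypothesis P_ge0 : forall x y, 0 <= P x y.
Hypothesis P_sum1 : forall x, \sum_y P x y = 1.
Implicit Types (f g : X -> R) (s t : R) (x y : X).

Lemma kernel_pow_ge0 m x y : 0 <= kernel_pow P m x y.
Proof.
elim: m x y => [|m IHm] x y /=; first exact: ler0n.
by apply: sumr_ge0 => z _; rewrite mulr_ge0.
Qed.

Lemma sum_delta (F : X -> R) x : \sum_y (x == y)%:R * F y = F x.
Proof.
rewrite (bigD1 x)//= eqxx mul1r big1 ?addr0// => y.
by rewrite eq_sym => /negPf->; rewrite mul0r.
Qed.

Lemma kernel_pow_sum1 m x : \sum_y kernel_pow P m x y = 1.
Proof.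
elim: m x => [|m IHm] x /=.
  by rewrite -[RHS](sum_delta (fun=> 1) x); apply: eq_bigr => y _; rewrite mulr1.
rewrite exchange_big /= -[RHS](P_sum1 x); apply: eq_bigr => z _.
by rewrite -mulr_sumr IHm mulr1.
Qed.

Lemma kernel_pow_le1 m x y : `|kernel_pow P m x y| <= 1.
Proof.
rewrite ger0_norm ?kernel_pow_ge0// -(kernel_pow_sum1 m x) (bigD1 y)//= lerDl.
by apply: sumr_ge0 => z _; exact: kernel_pow_ge0.
Qed.

(** [kernel_pow] splits off the first step; splitting off the last one gives the forward equation
    and lets a final jump be added to a trajectory. *)
Lemma kernel_powSr m x y :
  kernel_pow P m.+1 x y = \sum_z P z y * kernel_pow P m x z.
Proof.
elim: m x y => [|m IHm] x y.
  rewrite /=; under eq_bigr do rewrite mulrC eq_sym.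
  by rewrite sum_delta; under eq_bigr do rewrite mulrC; rewrite sum_delta.
rewrite -[LHS]/(\sum_z P x z * kernel_pow P m.+1 z y).
under eq_bigr do rewrite IHm mulr_sumr.
rewrite exchange_big /=; apply: eq_bigr => z _.
by rewrite mulr_sumr; apply: eq_bigr => w _; rewrite mulrCA.
Qed.

Lemma heatE t x y :
  heat P t x y = expR (- t) * egf (fun m => kernel_pow P m x y) t.
Proof. by []. Qed.

Lemma heat_ge0 t x y : 0 <= t -> 0 <= heat P t x y.
Proof.
move=> t0; rewrite heatE mulr_ge0 ?expR_ge0//.
by apply: (@egf_ge0 _ _ 1) => // m; [exact: kernel_pow_le1|exact: kernel_pow_ge0].
Qed.

Lemma heat_gt0 t x y : (exists m, 0 < kernel_pow P m x y) -> 0 < t ->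
  0 < heat P t x y.
Proof.
move=> [m Pm] t0; rewrite heatE mulr_gt0 ?expR_gt0//.
have le1 n := kernel_pow_le1 n x y; have ge0 n := kernel_pow_ge0 n x y.
apply: lt_le_trans (@le_egf _ _ _ _ m le1 ge0 (ltW t0)).
by rewrite mulr_gt0// divr_gt0 ?exprn_gt0// ltr0n fact_gt0.
Qed.

Lemma heat0 x y : heat P 0 x y = (x == y)%:R.
Proof.
by rewrite heatE oppr0 expR0 mul1r (@egf0 _ _ 1)// => m; exact: kernel_pow_le1.
Qed.

Lemma heat_sum1 t x : \sum_y heat P t x y = 1.
Proof.
under eq_bigr do rewrite heatE.
rewrite -mulr_sumr.
have -> : \sum_y egf (fun m => kernel_pow P m x y) t = egf (fun=> 1) t.
  under eq_bigr do rewrite -[egf _ _]mul1r.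
  rewrite -(@egf_sum _ _ (fun y m => kernel_pow P m x y) (fun=> 1) 1).
    congr egf; apply/funext => m; under eq_bigr do rewrite mul1r.
    exact: kernel_pow_sum1.
  by move=> y m; exact: kernel_pow_le1.
by rewrite egf_cst -expRD addNr expR0.
Qed.

(** Common source of the backward and forward Kolmogorov equations: differentiation shifts the
    coefficients of [egf], and [c], [u] record which step of the shifted power is split off. *)
Let is_derive_heat_shift t x y (I : finType) (c : I -> R) (u : I -> X * X) :
  (forall m, kernel_pow P m.+1 x y =
    \sum_i c i * kernel_pow P m (u i).1 (u i).2) ->
  is_derive t 1 (fun s => heat P s x y)
    (\sum_i c i * heat P t (u i).1 (u i).2 - heat P t x y).
Proof.
move=> Pc; have he : is_derive t 1 (fun s : R => expR (- s)) (- expR (- t)).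
  rewrite -[X in is_derive _ _ _ X]mulrN1.
  by apply: (@is_derive1_comp _ expR -%R); exact: is_derive_expR.
have ha := @is_derive_egf _ _ 1 t (fun m => kernel_pow_le1 m x y).
apply: (eq_is_derive (is_derive_mulr he ha)).
rewrite addrC mulNr; congr (_ - _).
have -> : (fun m => kernel_pow P m x y) \o S =
    (fun m => \sum_i c i * kernel_pow P m (u i).1 (u i).2).
  by apply/funext => m; exact: Pc.
rewrite (@egf_sum _ _ (fun i m => kernel_pow P m (u i).1 (u i).2) c 1).
  by rewrite mulr_sumr; apply: eq_bigr => i _; rewrite heatE mulrCA.
by move=> i m; exact: kernel_pow_le1.
Qed.

Lemma is_derive_heat_l t x y : is_derive t 1 (fun s => heat P s x y)
  (\sum_z P x z * heat P t z y - heat P t x y).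
Proof. exact: (@is_derive_heat_shift t x y X (P x) (fun z => (z, y))). Qed.

Lemma is_derive_heat_r t x y : is_derive t 1 (fun s => heat P s x y)
  (\sum_z P z y * heat P t x z - heat P t x y).
Proof.
apply: (@is_derive_heat_shift t x y X (P ^~ y) (fun z => (x, z))) => m.
exact: kernel_powSr.
Qed.

Definition heat_op t g x : R := \sum_y heat P t x y * g y.

Lemma generatorE g x : generator P g x = \sum_y P x y * g y - g x.
Proof.
rewrite /generator; under eq_bigr do rewrite mulrBr.
by rewrite sumrB -mulr_suml P_sum1 mul1r.
Qed.

Lemma is_derive_heat_op t g x : is_derive t 1 (fun s => heat_op s g x)
  (generator P (heat_op t g) x).
Proof.
have h y : is_derive t 1 (fun s => heat P s x y * g y)
    ((\sum_z P x z * heat P t z y - heat P t x y) * g y).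
  exact/is_derive_mulrc/is_derive_heat_l.
apply: (eq_is_derive (is_derive_sumr (df := fun y t =>
  (\sum_z P x z * heat P t z y - heat P t x y) * g y) h)).
rewrite generatorE; under eq_bigr do rewrite mulrBl.
rewrite sumrB; congr (_ - _).
under eq_bigr do rewrite mulr_suml.
rewrite exchange_big /=; apply: eq_bigr => z _.
by rewrite mulr_sumr; apply: eq_bigr => y _; rewrite mulrA.
Qed.

(** Product rule for [P_s (g_s)]: by the forward equation the derivative of the kernel becomes the
    generator acting on [g_s] inside the semigroup. *)
Lemma is_derive_heat_op_path t (g dg : R -> X -> R) x :
  (forall y, is_derive t 1 (fun s => g s y) (dg t y)) ->
  is_derive t 1 (fun s => heat_op s (g s) x)
    (heat_op t (fun y => generator P (g t) y + dg t y) x).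
Proof.
move=> hg; pose dh t y := \sum_z P z y * heat P t x z - heat P t x y.
apply: eq_is_derive.
  apply: (is_derive_sumr (df := fun y t =>
    dh t y * g t y + heat P t x y * dg t y)) => y.
  by apply: is_derive_mulr; first exact: is_derive_heat_r.
rewrite big_split /heat_op /=; under [RHS]eq_bigr do rewrite mulrDr.
rewrite big_split; congr (_ + _); rewrite /dh.
under [RHS]eq_bigr do rewrite generatorE mulrBr.
under [LHS]eq_bigr do rewrite mulrBl.
rewrite !sumrB; congr (_ - _).
under [LHS]eq_bigr do rewrite mulr_suml.
under [RHS]eq_bigr do rewrite mulr_sumr.
rewrite exchange_big /=; apply: eq_bigr => y _; apply: eq_bigr => z _.
ring.
Qed.

Lemma is_derive_heat_op_rev T s g x :
  is_derive s 1 (fun r => heat_op (T - r) g x)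
    (- generator P (heat_op (T - s) g) x).
Proof.
apply: (@is_derive_revr _ (fun r => heat_op r g x)).
exact: is_derive_heat_op.
Qed.

Lemma heat_op0 g : heat_op 0 g = g.
Proof.
apply/funext => x; rewrite /heat_op; under eq_bigr do rewrite heat0.
exact: sum_delta.
Qed.

Lemma le_heat_op t f g x : 0 <= t -> (forall y, f y <= g y) ->
  heat_op t f x <= heat_op t g x.
Proof.
by move=> t0 fg; apply: ler_sum => y _; rewrite ler_wpM2l ?heat_ge0.
Qed.

Lemma heat_op_cst t c x : heat_op t (fun=> c) x = c.
Proof. by rewrite /heat_op -mulr_suml heat_sum1 mul1r. Qed.

(** The path [P_r (P_(s + t - r) g)] has derivative zero, as its forward and backward contributions
    cancel; its values at [r = 0] and [r = s] are the two sides. *)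
Lemma heat_opD s t g : heat_op s (heat_op t g) = heat_op (s + t) g.
Proof.
apply/funext => x.
pose G (r : R) := heat_op r (heat_op (s + t - r) g) x.
have dG (r : R) : is_derive r 1 G 0.
  apply: eq_is_derive.
    apply: (is_derive_heat_op_path (dg := fun r y =>
      - generator P (heat_op (s + t - r) g) y)) => y.
    exact: is_derive_heat_op_rev.
  rewrite /heat_op big1// => y _.
  by rewrite [X in _ * X](_ : _ = 0) ?mulr0//; exact: subrr.
have Gs a b : a <= b -> G a = G b.
  move=> ab; apply/le_anti/andP; split.
    exact: (@nondecreasing_is_derive _ G (fun=> 0) a b).
  rewrite -lerN2.
  apply: (@nondecreasing_is_derive _ (fun r => - G r) (fun=> 0)) => // r _.
  by rewrite -[X in is_derive _ _ _ X]oppr0; exact: is_derive_oppr.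
have [s0|/ltW s0] := leP 0 s.
  have := Gs 0 s s0.
  by rewrite /G subr0 heat_op0 (addrC s) addrK => ->.
have := Gs s 0 s0.
by rewrite /G subr0 heat_op0 (addrC s) addrK => ->.
Qed.

End heat_semigroup.

(** * Curvature, gradient bound and local Poincare inequality *)

Section curvature.
Context {R : realType} {X : finType} (P : X -> X -> R).
Hypothesis P_ge0 : forall x y, 0 <= P x y.
Hypothesis P_sum1 : forall x, \sum_y P x y = 1.
Implicit Types (f g : X -> R) (s t : R) (x y : X).

Lemma Gamma_ge0 f x : 0 <= Gamma P f x.
Proof.
rewrite mulr_ge0 ?invr_ge0//; apply: sumr_ge0 => y _.
by rewrite mulr_ge0// -expr2 sqr_ge0.
Qed.

(** The supremum is not known to be attained. If the inequality failed by [A - B], some admissible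
    [kappa] would exceed [- (A - B) / (G + 1)], and its defect [- kappa * G] would be smaller than
    [A - B]. Adding 1 to [G] covers [G = 0]. *)
Lemma BE_ge0_curvature f x : (0%:E <= BE P)%E ->
  carre_du_champ P f (generator P f) x <= 2^-1 * generator P (Gamma P f) x.
Proof.
move=> BE0; rewrite leNgt; apply/negP => lt_AB.
set A := carre_du_champ _ _ _ _ in lt_AB; set B := _ * _ in lt_AB.
have G0 := Gamma_ge0 f x; set G := Gamma P f x in G0.
have d0 : 0 < (A - B) / (G + 1) by rewrite divr_gt0 ?subr_gt0 ?ltr_wpDl.
have : ((- ((A - B) / (G + 1)))%:E < BE P)%E.
  by apply: lt_le_trans BE0; rewrite lte_fin oppr_lt0.
move=> /ereal_sup_gt[_ [k kP <-]]; rewrite lte_fin => kd.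
have := kP f x; rewrite -/A -/B -/G.
apply/negP; rewrite -ltNge -ltrBlDl.
rewrite ltrNl in kd.
have [G_eq0|G_gt0] := leP G 0.
  have -> : G = 0 by apply/le_anti/andP.
  by rewrite mulr0 subr_lt0.
have : - k * G < (A - B) / (G + 1) * G by rewrite ltr_pM2r.
have : (A - B) / (G + 1) * G < A - B.
  by rewrite mulrAC ltr_pdivrMr ?ltr_wpDl// ltr_pM2l ?subr_gt0// ltrDl.
lra.
Qed.

Lemma is_derive_Gamma t (g dg : R -> X -> R) x :
  (forall y, is_derive t 1 (fun s => g s y) (dg t y)) ->
  is_derive t 1 (fun s => Gamma P (g s) x)
    (2 * carre_du_champ P (g t) (dg t) x).
Proof.
move=> hg; have hd y : is_derive t 1 (fun s => g s x - g s y) (dg t x - dg t y).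
  exact: is_derive_subr.
have hs := is_derive_sumr (df := fun y t =>
  2 * ((g t x - g t y) * (dg t x - dg t y) * P x y)) (x := t)
  (f := fun y s => (g s x - g s y) * (g s x - g s y) * P x y).
apply: eq_is_derive.
  apply: (is_derive_mulr (is_derive_cst (2^-1 : R) t 1) (hs _)) => y.
  apply: (eq_is_derive (is_derive_mulr (is_derive_mulr (hd y) (hd y))
    (is_derive_cst (P x y) t 1))).
  by rewrite /cst /=; ring.
by rewrite mul0r add0r /cst -mulr_sumr /carre_du_champ; lra.
Qed.

Lemma generator_sqr g x :
  generator P (fun y => g y ^+ 2) x - 2 * g x * generator P g x
  = 2 * Gamma P g x.
Proof.
rewrite /Gamma /carre_du_champ mulrA mulfV// mul1r /generator mulr_sumr.
rewrite -sumrB; apply: eq_bigr => y _; ring.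
Qed.

Section local_poincare.
Hypothesis curv : forall f x,
  carre_du_champ P f (generator P f) x <= 2^-1 * generator P (Gamma P f) x.

Lemma carre_du_champNr f g x :
  carre_du_champ P f (fun y => - g y) x = - carre_du_champ P f g x.
Proof.
rewrite /carre_du_champ -mulrN -sumrN; congr (_ * _).
by apply: eq_bigr => y _; ring.
Qed.

(** With [g = P_(t - r) f], the derivative in [r] of [P_r (Gamma g)] is [P_r] of
    [L (Gamma g) - 2 Gamma (g, L g)], nonnegative by curvature; compare [r = s] with [r = t]. *)
Lemma Gamma_heat_op s t f x : 0 <= s <= t ->
  heat_op P s (Gamma P (heat_op P (t - s) f)) x <= heat_op P t (Gamma P f) x.
Proof.
move=> /andP[s0 st].
pose g r := heat_op P (t - r) f.
have := @nondecreasing_is_derive _ (fun r => heat_op P r (Gamma P (g r)) x)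
  (fun r => heat_op P r (fun y => generator P (Gamma P (g r)) y
    + 2 * carre_du_champ P (g r) (fun z => - generator P (g r) z) y) x) s t st.
rewrite /g subrr heat_op0//; apply => r /andP[sr rt].
  apply: (is_derive_heat_op_path P_ge0 P_sum1 (g := fun r => Gamma P (g r))
    (dg := fun r y =>
    2 * carre_du_champ P (g r) (fun z => - generator P (g r) z) y)) => y.
  apply: (is_derive_Gamma (dg := fun r z => - generator P (g r) z)) => z.
  exact: is_derive_heat_op_rev.
rewrite -[leLHS](@heat_op_cst _ _ _ P_ge0 P_sum1 r 0 x).
apply: le_heat_op => //; first exact: le_trans sr.
by move=> y; rewrite carre_du_champNr; have := curv (g r) y; rewrite -/(g r); lra.
Qed.

(** The derivative in [r] of [P_r ((P_(t - r) f) ^ 2)] is [2 P_r (Gamma (P_(t - r) f))], at most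
    [2 K] by [Gamma_heat_op]. Subtracting the path from [2 K r] turns integration over [[0, t]] into
    monotonicity. *)
Lemma local_poincare t f x : 0 <= t ->
  heat_op P t (fun y => f y ^+ 2) x - heat_op P t f x ^+ 2
  <= 2 * t * heat_op P t (Gamma P f) x.
Proof.
move=> t0; pose g r := heat_op P (t - r) f; set K := heat_op P t (Gamma P f) x.
have := @nondecreasing_is_derive _
  (fun r => r * (2 * K) - heat_op P r (fun y => g r y ^+ 2) x)
  (fun r => 2 * K - heat_op P r (fun y => 2 * Gamma P (g r) y) x) 0 t t0.
rewrite /g subrr subr0 !heat_op0// mul0r sub0r => h.
suff: - heat_op P t f x ^+ 2 <= t * (2 * K) - heat_op P t (fun y => f y ^+ 2) x.
  lra.
apply: h => r r0t.
  apply: is_derive_subr.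
    by rewrite -[X in is_derive _ _ _ X]mul1r; exact: is_derive_mulrc.
  apply: (eq_is_derive (is_derive_heat_op_path P_ge0 P_sum1
    (g := fun r y => g r y ^+ 2)
    (dg := fun r y => - (2 * g r y * generator P (g r) y)) x _)) => [y|].
    apply: (@eq_is_derive _ (fun s => g s y * g s y)).
      apply: is_derive_mulr; exact: is_derive_heat_op_rev.
    by rewrite -/(g r) /=; ring.
  by congr (heat_op P r _ x); apply/funext => y; exact: generator_sqr.
rewrite /heat_op; under eq_bigr do rewrite mulrCA.
by rewrite -mulr_sumr -mulrBr mulr_ge0// subr_ge0; exact: Gamma_heat_op.
Qed.

End local_poincare.
End curvature.

(** * Exponential decay of the variance under a Poincare inequality *)

Section l2_decay.
Context {R : realType} {X : finType} (P : X -> X -> R) (pi : X -> R).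
Hypothesis P_ge0 : forall x y, 0 <= P x y.
Hypothesis P_sum1 : forall x, \sum_y P x y = 1.
Hypothesis pi_stat : is_stationary P pi.
Implicit Types (f g : X -> R) (s t : R) (x y : X).

Lemma mean_generator f : mean pi (generator P f) = 0.
Proof.
have [_ _ piP] := pi_stat.
rewrite /mean; under eq_bigr do rewrite generatorE// mulrBl mulr_suml.
rewrite sumrB exchange_big /=; apply/eqP; rewrite subr_eq0; apply/eqP.
apply: eq_bigr => y _; rewrite -[in RHS]piP mulr_sumr.
by apply: eq_bigr => x _; ring.
Qed.

Lemma is_derive_mean t (g dg : R -> X -> R) :
  (forall y, is_derive t 1 (fun s => g s y) (dg t y)) ->
  is_derive t 1 (fun s => mean pi (g s)) (mean pi (dg t)).
Proof.
move=> hg; apply: (is_derive_sumr (df := fun y t => dg t y * pi y)) => y.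
exact: is_derive_mulrc.
Qed.

Lemma mean_heat_op t g : 0 <= t -> mean pi (heat_op P t g) = mean pi g.
Proof.
have h (s : R) : is_derive s 1 (fun s => mean pi (heat_op P s g)) 0.
  apply: eq_is_derive; last exact: (mean_generator (heat_op P s g)).
  apply: (is_derive_mean (g := fun s => heat_op P s g)
    (dg := fun s => generator P (heat_op P s g))) => y.
  exact: is_derive_heat_op.
move=> t0; rewrite -[in RHS](heat_op0 P_ge0 P_sum1 g).
apply/le_anti/andP; split; last first.
  exact: (@nondecreasing_is_derive _
    (fun s => mean pi (heat_op P s g)) (fun=> 0)).
rewrite -lerN2.
apply: (@nondecreasing_is_derive _
  (fun s => - mean pi (heat_op P s g)) (fun=> 0)) => // r _.
by rewrite -[X in is_derive _ _ _ X]oppr0; exact: is_derive_oppr.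
Qed.

Lemma mean_sqr_sub f (c : R) : mean pi (fun x => (f x - c) ^+ 2) =
  mean pi (fun x => f x ^+ 2) - 2 * c * mean pi f + c ^+ 2.
Proof.
have [_ pi1 _] := pi_stat.
transitivity (mean pi (fun x => f x ^+ 2) - 2 * c * mean pi f
    + c ^+ 2 * \sum_x pi x); last by rewrite pi1 mulr1.
rewrite /mean !mulr_sumr -sumrB -big_split /=; apply: eq_bigr => x _; ring.
Qed.

Lemma varianceE f : variance pi f = mean pi (fun x => f x ^+ 2) - mean pi f ^+ 2.
Proof. by rewrite /variance mean_sqr_sub; ring. Qed.

Lemma variance_le f (c : R) : variance pi f <= mean pi (fun x => (f x - c) ^+ 2).
Proof.
by rewrite varianceE mean_sqr_sub; have := sqr_ge0 (mean pi f - c); lra.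
Qed.

Lemma is_derive_variance_heat t g :
  is_derive t 1 (fun s => mean pi (fun x => heat_op P s g x ^+ 2))
    (- (2 * dirichlet P pi (heat_op P t g))).
Proof.
apply: eq_is_derive.
  apply: (is_derive_mean (g := fun s x => heat_op P s g x ^+ 2)
    (dg := fun s x => 2 * heat_op P s g x * generator P (heat_op P s g) x)) => y.
  apply: (@eq_is_derive _ (fun s => heat_op P s g y * heat_op P s g y)).
    by apply: is_derive_mulr; exact: is_derive_heat_op.
  by rewrite /=; ring.
set h := heat_op P t g; rewrite -[LHS]subr0 -(mean_generator (fun y => h y ^+ 2)).
rewrite /mean /dirichlet -sumrB mulr_sumr -sumrN; apply: eq_bigr => x _.
rewrite -(subrK (2 * h x * generator P h x) (generator P (fun y => h y ^+ 2) x)).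
by rewrite generator_sqr /= -/h; ring.
Qed.

(** Gronwall argument: the variance has derivative [- 2 E(P_r g)], at most [- 2 / T] times itself,
    so its product with [exp (2 r / T)] is nonincreasing. *)
Lemma variance_heat_op T s g : 0 < T ->
  (forall f, variance pi f <= T * dirichlet P pi f) -> 0 <= s ->
  variance pi (heat_op P s g) <= expR (- (2 * s / T)) * variance pi g.
Proof.
move=> T0 poinc s0.
(* The mean is frozen at its initial value, so that only the second moment has to be
   differentiated. *)
pose V r := mean pi (fun x => heat_op P r g x ^+ 2) - mean pi g ^+ 2.
have VE r : 0 <= r -> variance pi (heat_op P r g) = V r.
  by move=> r0; rewrite varianceE mean_heat_op.
have hV (r : R) : is_derive r 1 V (- (2 * dirichlet P pi (heat_op P r g))).
  rewrite -[X in is_derive _ _ _ X]subr0.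
  by apply: is_derive_subr; exact: is_derive_variance_heat.
have hl (r : R) : is_derive r 1 (fun s : R => s * (2 / T)) (2 / T).
  by rewrite -[X in is_derive _ _ _ X]mul1r; exact: is_derive_mulrc.
have he (r : R) : is_derive r 1 (fun s : R => expR (s * (2 / T)))
    (expR (r * (2 / T)) * (2 / T)).
  exact: (@is_derive1_comp _ expR (fun s : R => s * (2 / T))).
have /(_ s0) := @nondecreasing_is_derive _
  (fun r => - (expR (r * (2 / T)) * V r))
  (fun r => expR (r * (2 / T))
    * (2 * dirichlet P pi (heat_op P r g) - 2 / T * V r)) 0 s.
rewrite -!VE// mul0r expR0 mul1r heat_op0// => h.
rewrite expRN mulrC ler_pdivlMr ?expR_gt0// mulrC.
rewrite (_ : 2 * s / T = s * (2 / T)); last by ring.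
rewrite -lerN2; apply: h => r /andP[r0 rs].
  apply: (eq_is_derive (is_derive_oppr (is_derive_mulr (he r) (hV r)))).
  by rewrite /=; ring.
rewrite mulr_ge0 ?expR_ge0// subr_ge0 -VE//.
by have := poinc (heat_op P r g); rewrite -ler_pdivrMl//; lra.
Qed.

End l2_decay.

(** * Stationary law and relaxation time of an irreducible chain *)

Section irreducible_chains.
Context {R : realType} {X : finType} (C : irreducible_chain R X) (pi : X -> R).
Hypothesis pi_stat : is_stationary C pi.
Implicit Types (f g w : X -> R) (s t : R) (x y z : X) (m n : nat).

Let C_ge0 := transition_ge0 C.
Let C_sum1 := transition_sum1 C.

Lemma kernel_powS_gt0 m x y : 0 < kernel_pow C m.+1 x y ->
  exists2 z, 0 < C x z & 0 < kernel_pow C m z y.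
Proof.
move=> h; apply: contrapT => nz; move: h; apply/negP; rewrite -leNgt /=.
apply: sumr_le0 => z _; rewrite leNgt; apply/negP => h; apply: nz; exists z.
  rewrite lt0r C_ge0 andbT; apply: contraTneq h => ->.
  by rewrite mul0r ltxx.
rewrite lt0r kernel_pow_ge0// andbT; apply: contraTneq h => ->.
by rewrite mulr0 ltxx.
Qed.

Lemma stationary_kernel_pow m y : \sum_x pi x * kernel_pow C m x y = pi y.
Proof.
have [_ _ piP] := pi_stat; elim: m y => [|m IHm] y.
  rewrite /=; under eq_bigr do rewrite mulrC eq_sym.
  exact: sum_delta.
under eq_bigr do rewrite /= mulr_sumr.
rewrite exchange_big /= -[RHS]IHm; apply: eq_bigr => z _.
by under eq_bigr do rewrite mulrA; rewrite -mulr_suml piP.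
Qed.

(** Some state has positive mass because the total is 1, and stationarity transports this mass to
    [x] along a path. *)
Lemma stationary_gt0 x : 0 < pi x.
Proof.
have [pi0 pi1 _] := pi_stat.
have [y piy] : exists y, 0 < pi y.
  apply: contrapT => npi; have : \sum_y pi y <= 0.
    apply: sumr_le0 => y _; rewrite leNgt; apply/negP => h.
    by apply: npi; exists y.
  by rewrite pi1 ler10.
have [m Pm] := chain_irreducible C y x.
rewrite -(stationary_kernel_pow m x) (bigD1 y)//= ltr_pwDl ?mulr_gt0//.
by apply: sumr_ge0 => z _; rewrite mulr_ge0// kernel_pow_ge0.
Qed.

Lemma dirichlet_ge0 f : 0 <= dirichlet C pi f.
Proof.
by apply: sumr_ge0 => x _; rewrite mulr_ge0 ?Gamma_ge0 ?(ltW (stationary_gt0 x)).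
Qed.

Lemma edge_le_dirichlet f x y :
  2^-1 * ((f x - f y) ^+ 2 * C x y) * pi x <= dirichlet C pi f.
Proof.
have pi0 z := ltW (stationary_gt0 z).
rewrite /dirichlet (bigD1 x)//= -[leLHS]addr0 lerD//; last first.
  by apply: sumr_ge0 => z _; rewrite mulr_ge0 ?Gamma_ge0.
rewrite ler_wpM2r// ler_wpM2l ?invr_ge0// (bigD1 y)//= -expr2 lerDl.
by apply: sumr_ge0 => z _; rewrite mulr_ge0// -expr2 sqr_ge0.
Qed.

Lemma path_le_dirichlet m x y : 0 < kernel_pow C m x y ->
  exists K, forall f, (f x - f y) ^+ 2 <= K * dirichlet C pi f.
Proof.
elim: m x => [x|m IHm x].
  rewrite /= ltr0n lt0b => /eqP ->; exists 0 => f.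
  by rewrite subrr mul0r expr0n.
move=> /kernel_powS_gt0[z Pz /IHm[K hK]].
exists (2 * (2 / (C x z * pi x)) + 2 * K) => f.
have Q0 : 0 < C x z * pi x by rewrite mulr_gt0 ?stationary_gt0.
have h : (f x - f z) ^+ 2 <= 2 / (C x z * pi x) * dirichlet C pi f.
  by rewrite mulrAC ler_pdivlMr//; have := edge_le_dirichlet f x z; lra.
rewrite mulrDl -mulrA; have := hK f.
have : (f x - f y) ^+ 2 <= 2 * (f x - f z) ^+ 2 + 2 * (f z - f y) ^+ 2.
  by have := sqr_ge0 ((f x - f z) - (f z - f y)); lra.
lra.
Qed.

(** Only the finiteness of [K] matters: it bounds the set defining [t_rel], whose supremum is then
    an upper bound. *)
Lemma poincare_exists : exists K, forall f,
  variance pi f <= K * dirichlet C pi f.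
Proof.
have /card_gt0P[x0 _] : (0 < #|X|)%N by exact: leq_trans (chain_card_ge2 C).
have /choice[K hK] x : exists K, forall f,
    (f x - f x0) ^+ 2 <= K * dirichlet C pi f.
  by have [m] := chain_irreducible C x x0; exact: path_le_dirichlet.
exists (\sum_x K x * pi x) => f; apply: le_trans (variance_le pi_stat f (f x0)) _.
rewrite mulr_suml; apply: ler_sum => x _ /=; rewrite [leRHS]mulrAC.
by rewrite ler_wpM2r// ltW// stationary_gt0.
Qed.

Lemma poincare_t_rel f : variance pi f <= t_rel C pi * dirichlet C pi f.
Proof.
have [K hK] := poincare_exists; have := dirichlet_ge0 f.
(* A function of zero Dirichlet form is outside the set defining [t_rel]; the crude constant [K]
   shows that its variance is nonpositive. *)
rewrite le_eqVlt => /predU1P[E0|E0].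
  by have := hK f; rewrite -E0 !mulr0.
rewrite -ler_pdivrMr//; apply: ub_le_sup; last by exists f.
by exists K => _ [g /= Eg <-]; rewrite ler_pdivrMr.
Qed.

Lemma t_rel_gt0 : 0 < t_rel C pi.
Proof.
have /card_gt1P[x [y [_ _ xy]]] := chain_card_ge2 C.
pose f z : R := (z == x)%:R.
have pi0 z := ltW (stationary_gt0 z).
have V0 z : (f z - mean pi f) ^+ 2 * pi z <= variance pi f.
  rewrite /variance [X in _ <= X]/mean (bigD1 z)//= lerDl.
  by apply: sumr_ge0 => u _; rewrite mulr_ge0 ?sqr_ge0.
have Vf : 0 < variance pi f.
  rewrite ltNge; apply/negP => Vle0; have fE z : f z = mean pi f.
    have := le_trans (V0 z) Vle0; rewrite pmulr_lle0 ?stationary_gt0// => h.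
    by apply/eqP; rewrite -subr_eq0 -sqrf_eq0 eq_le h sqr_ge0.
  have : f x = f y by rewrite !fE.
  by rewrite /f eqxx eq_sym (negPf xy) => /eqP; rewrite oner_eq0.
have := lt_le_trans Vf (poincare_t_rel f).
apply: contraTT; rewrite -!leNgt => T0.
by rewrite mulr_le0_ge0 ?dirichlet_ge0.
Qed.

(** One-step comparisons are compounded along a path. Loops satisfy the comparison because [c <= 1],
    so it is assumed for proper edges only. *)
Lemma propagate w (c : R) m x y : 0 <= c <= 1 -> (forall z, 0 <= w z) ->
  (forall z z', z != z' -> 0 < C z z' -> c * w z <= w z') ->
  0 < kernel_pow C m x y -> c ^+ m * w x <= w y.
Proof.
move=> /andP[c0 c1] w0 cw; elim: m x => [x|m IHm x].
  by rewrite /= ltr0n lt0b => /eqP ->; rewrite mul1r.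
move=> /kernel_powS_gt0[z Pz /IHm h]; apply: le_trans h.
rewrite exprSr -mulrA ler_wpM2l ?exprn_ge0//.
have [<-|xz] := eqVneq x z; last exact: cw.
by rewrite ler_piMl.
Qed.

(** * Edge probabilities and directed distances *)

Lemma transition_le1 x y : C x y <= 1.
Proof. by rewrite -(C_sum1 x) (bigD1 y)//= lerDl sumr_ge0. Qed.

Lemma kernel_pow1 x y : kernel_pow C 1 x y = C x y.
Proof.
by rewrite /=; under eq_bigr do rewrite mulrC eq_sym; rewrite sum_delta.
Qed.

Lemma chain_Delta_ge x y : x != y -> 0 < C x y -> (C x y)^-1 <= chain_Delta C.
Proof.
move=> xy Cxy; rewrite /chain_Delta.
apply: (@le_bigmax_cond _ _ _ _ (x, y) _ (fun p : X * X => (C p.1 p.2)^-1)).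
by rewrite /= xy.
Qed.

Lemma exists_edge : exists x y, x != y /\ 0 < C x y.
Proof.
have /card_gt1P[x [y [_ _ xy]]] := chain_card_ge2 C.
have [m] := chain_irreducible C x y.
elim: m x xy => [|m IHm] x xy; first by rewrite /= (negPf xy) ltxx.
move=> /kernel_powS_gt0[z Pz hm]; have [xz|xz] := eqVneq x z.
  by subst z; exact: IHm hm.
by exists x, z.
Qed.

Lemma chain_Delta_ge1 : 1 <= chain_Delta C.
Proof.
have [x [y [xy Cxy]]] := exists_edge.
by apply: le_trans (chain_Delta_ge xy Cxy); rewrite invf_ge1// transition_le1.
Qed.

Let L := ln (chain_Delta C).

Lemma ln_chain_Delta_ge0 : 0 <= L.
Proof. exact/ln_ge0/chain_Delta_ge1. Qed.

Lemma transition_ge x y : x != y -> 0 < C x y -> expR (- L) <= C x y.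
Proof.
move=> xy Cxy; have D0 := lt_le_trans ltr01 chain_Delta_ge1.
rewrite expRN lnK// -[leRHS]invrK lef_pV2 ?posrE ?invr_gt0//.
exact: chain_Delta_ge.
Qed.

(** [chain_Delta] controls off-diagonal entries only, so loops are deleted from the path; this is
    why the length may drop from [m] to [d]. *)
Lemma kernel_pow_ge_Delta m x y : 0 < kernel_pow C m x y ->
  exists2 d, (d <= m)%N & expR (- L) ^+ d <= kernel_pow C d x y.
Proof.
elim: m x => [x|m IHm x].
  by rewrite /= ltr0n lt0b => /eqP ->; exists 0%N; rewrite //= eqxx.
move=> /kernel_powS_gt0[z Pz /IHm[d dm hd]]; have [xz|xz] := eqVneq x z.
  by exists d; [exact: leqW|rewrite xz].
exists d.+1 => //=; rewrite (bigD1 z)//= exprS.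
apply: le_trans (_ : C x z * kernel_pow C d z y <= _).
  by apply: ler_pM => //; rewrite ?exprn_ge0 ?expR_ge0 ?transition_ge.
by rewrite lerDl; apply: sumr_ge0 => u _; rewrite mulr_ge0// kernel_pow_ge0.
Qed.

Lemma chain_dist_gt0 x y : 0 < kernel_pow C (chain_dist C x y) x y.
Proof. by rewrite /chain_dist; case: ex_minnP. Qed.

Lemma chain_dist_le_diam x y : (chain_dist C x y <= chain_diam C)%N.
Proof.
exact: (@leq_bigmax _ (fun p : X * X => chain_dist C p.1 p.2) (x, y)).
Qed.

Lemma chain_dist_edge x y : x != y -> 0 < C x y -> chain_dist C x y = 1%N.
Proof.
move=> xy Cxy; rewrite /chain_dist; case: ex_minnP => -[|m] Pm min.
  by move: Pm; rewrite /= (negPf xy) ltxx.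
by apply/eqP; rewrite eqn_leq ltnS leqn0 -leqn0 -ltnS min ?kernel_pow1.
Qed.

Lemma chain_dist_rev_le x y : x != y -> 0 < C x y ->
  (chain_dist C y x <= chain_k C)%N.
Proof.
move=> xy Cxy.
apply: (@leq_bigmax_cond _ _ (fun p : X * X => chain_dist C p.2 p.1) (x, y)).
by rewrite /= chain_dist_edge.
Qed.

Lemma chain_k_gt0 : (0 < chain_k C)%N.
Proof.
have [x [y [xy Cxy]]] := exists_edge.
apply: leq_trans (chain_dist_rev_le xy Cxy).
have := chain_dist_gt0 y x; case: chain_dist => //=.
by rewrite eq_sym (negPf xy) ltxx.
Qed.

Lemma chain_diam_gt0 : (0 < chain_diam C)%N.
Proof.
have [x [y [xy Cxy]]] := exists_edge.
by apply: leq_trans (chain_dist_le_diam x y); rewrite chain_dist_edge.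
Qed.

End irreducible_chains.

(** * Logarithmic gradient of the heat kernel *)

Section logarithmic_gradient.
Context {R : realType} {X : finType} (C : irreducible_chain R X).
Implicit Types (s t : R) (x y z o : X) (m n d : nat).

Let C_ge0 := transition_ge0 C.
Let C_sum1 := transition_sum1 C.

(** The crude value 4 suffices, since it is at most [k + 3]. *)
Lemma expR_1_le4 : expR 1 <= 4 :> R.
Proof.
have h : expR 2^-1 <= 2 :> R.
  rewrite -[leRHS]invrK -[expR _]invrK -expRN lef_pV2 ?posrE ?expR_gt0 ?invr_gt0//.
  by have := expR_ge1Dx (- 2^-1 : R); lra.
have -> : (1 : R) = 2^-1 + 2^-1 by lra.
rewrite expRD; apply: le_trans (ler_pM _ _ h h) _; rewrite ?expR_ge0//; lra.
Qed.

(** If [m + 1 <= B] the right side is at least [1 / B]; otherwise the left side is nonpositive. The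
    exponential form of the cutoff makes its sum against Poisson weights explicit. *)
Lemma le_invS_expR m (B : R) : 0 < B ->
  (1 - expR (m.+1%:R - B)) / B <= m.+1%:R^-1.
Proof.
move=> B0; rewrite ler_pdivrMr//; have m0 : 0 < m.+1%:R :> R by rewrite ltr0n.
have [mB|Bm] := leP m.+1%:R B.
  apply: (@le_trans _ _ 1); first by rewrite gerBl expR_ge0.
  by rewrite ler_pdivlMl ?mulr1.
apply: (@le_trans _ _ 0); last by rewrite mulr_ge0 ?invr_ge0// ltW.
by rewrite subr_le0 -[leLHS]expR0 ler_expR subr_ge0 ltW.
Qed.

(* Given [X_t = z], the expected number of jumps is at most about
   [(e - 1) t + ln (1 / p)], and dropping the last jump costs [t / (N + 1)]. *)
Lemma heat_step_ge t o z z' (B : R) : 0 < t -> 0 < B ->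
  C z z' * (t / B) * (heat C t o z - expR (1 - B + (expR 1 - 1) * t))
  <= heat C t o z'.
Proof.
move=> t0 B0; have t_ge0 := ltW t0.
pose a m := kernel_pow C m o z; pose b m := kernel_pow C m o z'.
have a1 m : `|a m| <= 1 by exact: kernel_pow_le1.
have b1 m : `|b m| <= 1 by exact: kernel_pow_le1.
have b0 m : 0 <= b m by exact: kernel_pow_ge0.
pose e := expR 1 : R; pose c := C z z' * (t / B).
have c0 : 0 <= c by rewrite mulr_ge0// ltW// divr_gt0.
pose u m := t ^+ m / m`!%:R * b m.
pose v m := c * (t ^+ m / m`!%:R * a m - expR (1 - B) * exp_coeff (e * t) m).
have u_ge0 m : 0 <= u m by rewrite mulr_ge0// mulr_ge0 ?exprn_ge0.
(* Trajectories whose last jump goes from [z] to [z'] give [b m.+1 >= C z z' * a m], and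
   [le_invS_expR] bounds the factor [1 / (m + 1)]. In the correction term [a m] is replaced by 1, so
   that it sums to an exponential. *)
have vu m : v m <= u m.+1.
  pose p := t ^+ m / m`!%:R; have p0 : 0 <= p by rewrite mulr_ge0 ?exprn_ge0.
  have -> : u m.+1 = t * m.+1%:R^-1 * p * b m.+1.
    by rewrite /u exprS factS natrM invfM /p; ring.
  have ba : C z z' * a m <= b m.+1.
    rewrite /b kernel_powSr (bigD1 z)//= lerDl; apply: sumr_ge0 => w _.
    by rewrite mulr_ge0// kernel_pow_ge0.
  have h1 : t * m.+1%:R^-1 * p * (C z z' * a m) <= t * m.+1%:R^-1 * p * b m.+1.
    by rewrite ler_wpM2l// mulr_ge0// mulr_ge0 ?invr_ge0.
  apply: le_trans h1.
  have a0 : 0 <= a m by exact: kernel_pow_ge0.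
  have h2 : (1 - expR (m.+1%:R - B)) / B * (t * p * (C z z' * a m)) <=
      m.+1%:R^-1 * (t * p * (C z z' * a m)).
    apply: ler_wpM2r; last exact: le_invS_expR.
    exact: mulr_ge0 (mulr_ge0 t_ge0 p0) (mulr_ge0 (C_ge0 _ _) a0).
  have -> : t * m.+1%:R^-1 * p * (C z z' * a m) =
    m.+1%:R^-1 * (t * p * (C z z' * a m)) by ring.
  apply: le_trans h2.
  have -> : expR (m.+1%:R - B) = expR (1 - B) * e ^+ m.
    by rewrite -natr1 -expRM_natl mulr1 -expRD; congr expR; ring.
  have -> : v m = c * p * a m - c * p * expR (1 - B) * e ^+ m.
    by rewrite /v /exp_coeff /= exprMn /p; ring.
  have -> : (1 - expR (1 - B) * e ^+ m) / B * (t * p * (C z z' * a m)) =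
    c * p * a m - c * p * expR (1 - B) * e ^+ m * a m by rewrite /c; ring.
  rewrite lerD2l lerN2; apply: ler_piMr; last exact: le_trans (ler_norm _) (a1 m).
  exact: mulr_ge0 (mulr_ge0 (mulr_ge0 c0 p0) (expR_ge0 _))
    (exprn_ge0 _ (expR_ge0 _)).
have v_cvg : series v n @[n --> \oo] -->
    c * (egf a t - expR (1 - B) * expR (e * t)).
  rewrite (_ : series v = fun n => c * (series (fun m => t ^+ m / m`!%:R * a m) n
      - expR (1 - B) * series (exp_coeff (e * t)) n)).
    apply: cvgMl_tmp; apply: cvgB; first exact: is_cvg_egf a1.
    apply: cvgMl_tmp; exact: is_cvg_series_exp_coeff.
  by apply/funext => n; rewrite /series /= mulr_sumr -sumrB mulr_sumr.
have h : c * (egf a t - expR (1 - B) * expR (e * t)) <= egf b t.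
  rewrite -(cvg_lim _ v_cvg)//; apply: limr_le.
    by apply/cvg_ex; eexists; exact: v_cvg.
  apply: nearW => n; apply: (@le_trans _ _ (series u n.+1)).
    by rewrite /series /= big_nat_recl//= -[leLHS]add0r lerD//; apply: ler_sum.
  apply: nondecreasing_cvgn_le; last exact: is_cvg_egf b1.
  by apply: nondecreasing_series => i _ _; exact: u_ge0.
rewrite !heatE -/a -/b -/c; have -> : expR (1 - B + (expR 1 - 1) * t) =
    expR (- t) * (expR (1 - B) * expR (e * t)).
  by rewrite -!expRD; congr expR; rewrite /e; ring.
by rewrite -mulrBr mulrCA ler_pM2l ?expR_gt0.
Qed.

Let L := ln (chain_Delta C).
Let k := chain_k C.

Lemma fact_le_expn d n : (d <= n)%N -> (d`! <= n ^ d)%N.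
Proof.
elim: d => // d IHd dn.
by rewrite factS expnS leq_mul// IHd// ltnW.
Qed.

(** Only the term of a loop-free path of length [d <= (k + 3) t] is kept:
    [d! <= d ^ d <= ((k + 3) t) ^ d] gives [t ^ d / d! >= (k + 3) ^ (- d)], and the path has
    probability at least [Delta ^ (- d)]. *)
Lemma heat_lower_bound t o z : 0 < t ->
  (chain_diam C)%:R <= (k%:R + 3) * t ->
  expR (- (t * (1 + (k%:R + 3) * (L + ln (k%:R + 3))))) <= heat C t o z.
Proof.
move=> t0 diam_t; set K := k%:R + 3.
have K1 : 1 <= K by rewrite /K -[leLHS]add0r lerD ?ler1n.
have K0 : 0 < K by exact: lt_le_trans K1.
have [d dD Pd] := kernel_pow_ge_Delta (chain_dist_gt0 C o z).
have {dD} dt : d%:R <= K * t.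
  by apply: le_trans diam_t; rewrite ler_nat (leq_trans dD) ?chain_dist_le_diam.
rewrite heatE; apply: (@le_trans _ _
  (expR (- t) * (t ^+ d / d`!%:R * kernel_pow C d o z))); last first.
  rewrite ler_wpM2l ?expR_ge0//; apply: (@le_egf _ _ 1) => //.
  - by move=> m; exact: kernel_pow_le1.
  - by move=> m; exact: kernel_pow_ge0.
  exact: ltW.
apply: (@le_trans _ _ (expR (- t) * (expR (- ln K) ^+ d * expR (- L) ^+ d))).
  rewrite -!expRM_natl -!expRD ler_expR.
  have L0 : 0 <= L + ln K by rewrite addr_ge0 ?ln_chain_Delta_ge0 ?ln_ge0.
  by have := ler_wpM2r L0 dt; lra.
rewrite ler_wpM2l ?expR_ge0// ler_pM ?exprn_ge0 ?expR_ge0//.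
rewrite expRN lnK ?posrE// exprVn ler_pdivlMr ?ltr0n ?fact_gt0//.
rewrite ler_pdivrMl ?exprn_gt0// -exprMn.
case: d dt {Pd} => [|d] dt; first by rewrite !expr0.
apply: (@le_trans _ _ (d.+1%:R ^+ d.+1)); last first.
  by rewrite lerXn2r ?nnegrE// ltW ?mulr_gt0.
by rewrite -natrX ler_nat fact_le_expn.
Qed.

Lemma heat_edge_ge t o z z' : 0 < t ->
  (chain_diam C)%:R <= (k%:R + 3) * t ->
  z != z' -> 0 < C z z' ->
  expR (- (2 * L + 2 * k%:R + 7)) * heat C t o z <= heat C t o z'.
Proof.
move=> t0 diam_t zz' Czz'; have := heat_lower_bound o z t0 diam_t.
set K := k%:R + 3; set p := heat C t o z; set q := expR (- (t * _)) => qp.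
have k1 : 1 <= k%:R :> R by rewrite ler1n chain_k_gt0.
have K0 : 0 < K by rewrite /K; lra.
have L0 : 0 <= L := ln_chain_Delta_ge0 C.
have p0 : 0 < p by apply: lt_le_trans qp; exact: expR_gt0.
have Kt1 : 1 <= K * t.
  by apply: le_trans diam_t; rewrite ler1n chain_diam_gt0.
have lnK0 : 0 <= ln K by apply: ln_ge0; rewrite /K; lra.
have lnKk : ln K <= k%:R + 2.
  rewrite (_ : K = 1 + (k%:R + 2)); last by rewrite /K; ring.
  by apply: le_ln1Dx; lra.
(* This choice makes the correction in [heat_step_ge] exactly [p / 2]. *)
pose B := 1 + (expR 1 - 1) * t + ln (2 / p).
have lnp : ln (2 / p) <= 1 + t * (1 + K * (L + ln K)).
  rewrite ln_div ?posrE// lerD//.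
    by have := @le_ln1Dx R 1; rewrite (_ : 1 + 1 = 2)//; apply; lra.
  by rewrite lerNl -ler_expR lnK ?posrE.
have lnp0 : 0 <= ln (2 / p).
  apply: ln_ge0; rewrite ler_pdivlMr// mul1r; apply: (@le_trans _ _ 1); last lra.
  rewrite -(heat_sum1 C_ge0 C_sum1 t o) (bigD1 z)//= lerDl.
  by apply: sumr_ge0 => w _; rewrite heat_ge0// ltW.
have e1 : 1 <= expR 1 :> R by have := expR_ge1Dx (1 : R); lra.
have B0 : 0 < B.
  have : 0 <= (expR 1 - 1) * t by apply: mulr_ge0; rewrite ?subr_ge0// ltW.
  by rewrite /B; lra.
(* The additive constants are absorbed by [1 <= K * t], and [e t] by [e <= 4 <= K]. *)
have BK : B <= K * t * (3 + L + ln K).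
  have : expR 1 * t <= K * t.
    by rewrite ler_pM2r//; apply: le_trans expR_1_le4 _; rewrite /K; lra.
  rewrite /B; lra.
have := heat_step_ge o z z' t0 B0; rewrite -/p.
have -> : expR (1 - B + (expR 1 - 1) * t) = p / 2.
  rewrite (_ : _ + _ = - ln (2 / p)); last by rewrite /B; ring.
  by rewrite expRN lnK ?posrE ?divr_gt0// invf_div.
apply: le_trans.
(* The exponent is [1 + (k + 2) + (L + k + 4)], from [2 <= e], [K <= exp (k + 2)] and
   [3 + L + ln K <= exp (L + k + 4)]. The remaining [L] in the statement pays for [C z z']. *)
have BA : 2 * (B / t) <= expR (L + 2 * k%:R + 7).
  have h1 : B / t <= K * (3 + L + ln K) by rewrite ler_pdivrMr//; lra.
  have -> : expR (L + 2 * k%:R + 7) =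
      expR 1 * (expR (k%:R + 2) * expR (L + k%:R + 4)).
    by rewrite -!expRD; congr expR; ring.
  apply: ler_pM => //.
  - by rewrite divr_ge0 // ltW.
  - by have := expR_ge1Dx (1 : R); lra.
  apply: le_trans h1 _; apply: ler_pM; [exact: ltW|lra| |].
    by apply: le_trans (expR_ge1Dx _); rewrite /K; lra.
  by apply: le_trans (expR_ge1Dx _); lra.
have -> : C z z' * (t / B) * (p - p / 2) = C z z' * (t / (2 * B)) * p.
  by field; lra.
rewrite ler_wpM2r ?(ltW p0)//.
have -> : - (2 * L + 2 * k%:R + 7) = - L + - (L + 2 * k%:R + 7) by ring.
rewrite expRD; apply: ler_pM; [exact: expR_ge0|exact: expR_ge0| |].
  exact: transition_ge.
rewrite expRN -[leRHS]invrK lef_pV2 ?posrE ?invr_gt0 ?divr_gt0 ?mulr_gt0//;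
  last exact: expR_gt0.
by rewrite invf_div -mulrA.
Qed.

Variable pi : X -> R.
Hypothesis pi_stat : is_stationary C pi.

(** Crossing the edge changes [ln w] by at most [a] and [ln pi] by at most [L] in one direction; the
    way back takes at most [k] edges and costs [k a] and [k L]. Both [a + k L] and [k a + L] are
    below the stated constant since [k >= 1]. *)
Lemma log_density_lipschitz t o x y : 0 < t ->
  (chain_diam C)%:R <= (k%:R + 3) * t ->
  0 < C x y ->
  `|ln (heat C t o x / pi x) - ln (heat C t o y / pi y)|
    <= 3 * k%:R ^+ 2 * (L + 4).
Proof.
move=> t0 diam_t Cxy.
have k1 : 1 <= k%:R :> R by rewrite ler1n chain_k_gt0.
have L0 : 0 <= L := ln_chain_Delta_ge0 C.
have k2 : k%:R <= k%:R ^+ 2 :> R by rewrite expr2 ler_pMl//; lra.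
have Lk := ler_wpM2l L0 k2; have L1 := ler_wpM2l L0 k1.
have bound0 : 0 <= 3 * k%:R ^+ 2 * (L + 4) by rewrite !mulr_ge0 ?sqr_ge0//; lra.
have [->|xy] := eqVneq x y; first by rewrite subrr normr0.
pose w := heat C t o; rewrite -/(w x) -/(w y).
have w0 z : 0 < w z.
  by apply: heat_gt0 => //; exact: chain_irreducible.
have p0 z : 0 < pi z := stationary_gt0 pi_stat z.
pose a := 2 * L + 2 * k%:R + 7.
have wstep z z' : z != z' -> 0 < C z z' -> expR (- a) * w z <= w z'.
  exact: heat_edge_ge.
have pstep z z' : z != z' -> 0 < C z z' -> expR (- L) * pi z <= pi z'.
  move=> zz' Czz'; apply: (@le_trans _ _ (pi z * C z z')).
    by rewrite mulrC ler_pM2l// transition_ge.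
  have [_ _ piP] := pi_stat; rewrite -(piP z') (bigD1 z)//= lerDl.
  by apply: sumr_ge0 => u _; rewrite mulr_ge0// ltW.
have a0 : 0 <= a by rewrite /a; lra.
have dk : (chain_dist C y x)%:R <= k%:R :> R.
  by rewrite ler_nat; exact: chain_dist_rev_le.
have back (v : X -> R) (c : R) : 0 <= c -> (forall z, 0 < v z) ->
    (forall z z', z != z' -> 0 < C z z' -> expR (- c) * v z <= v z') ->
    expR (- (k%:R * c)) * v y <= v x.
  move=> c0 v0 vstep; apply: (@le_trans _ _ (expR (- c) ^+ chain_dist C y x * v y)).
    rewrite ler_wpM2r ?(ltW (v0 y))// -expRM_natl ler_expR.
    by have := ler_wpM2r c0 dk; lra.
  apply: (propagate _ _ vstep (chain_dist_gt0 C y x)) => [|z]; last exact: ltW.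
  by rewrite expR_ge0 expR_le1 oppr_le0.
have ln_step (v : X -> R) (c : R) z z' : (forall u, 0 < v u) ->
    expR (- c) * v z <= v z' -> ln (v z) - ln (v z') <= c.
  move=> v0; rewrite -ler_ln ?posrE ?mulr_gt0 ?expR_gt0//.
  by rewrite lnM ?posrE ?expR_gt0// expRK; lra.
rewrite !ln_div ?posrE//.
have w1 := ln_step w _ _ _ w0 (wstep _ _ xy Cxy).
have w2 := ln_step w _ _ _ w0 (back w _ a0 w0 wstep).
have p1 := ln_step pi _ _ _ p0 (pstep _ _ xy Cxy).
have p2 := ln_step pi _ _ _ p0 (back pi _ L0 p0 pstep).
have aE : a = 2 * L + 2 * k%:R + 7 by [].
have ka : k%:R * a = 2 * (L * k%:R) + 2 * k%:R ^+ 2 + 7 * k%:R.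
  by rewrite /a; ring.
by rewrite ler_norml; apply/andP; split; lra.
Qed.

End logarithmic_gradient.

(** * From bounded varentropy to mixing *)

Section mixing.
Context {R : realType} {X : finType} (C : irreducible_chain R X) (pi : X -> R).
Hypothesis pi_stat : is_stationary C pi.
Implicit Types (s t : R) (x y z o : X).

Let C_ge0 := transition_ge0 C.
Let C_sum1 := transition_sum1 C.

Lemma tv_distE (mu nu : X -> R) : \sum_x mu x = 1 -> \sum_x nu x = 1 ->
  tv_dist mu nu = 1 - \sum_x Num.min (mu x) (nu x).
Proof.
move=> mu1 nu1; rewrite /tv_dist.
have -> : \sum_x `|mu x - nu x| =
    \sum_x mu x + \sum_x nu x - 2 * \sum_x Num.min (mu x) (nu x).
  rewrite mulr_sumr -big_split -sumrB /=; apply: eq_bigr => x _.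
  have [h|h] := leP (mu x) (nu x); first by rewrite ler0_norm ?subr_le0//; ring.
  by rewrite gtr0_norm ?subr_gt0//; ring.
by rewrite mu1 nu1; lra.
Qed.

(** The sign of [mu - nu] is an optimal test function; having a function to test against lets the
    semigroup act on it by duality. *)
Lemma tv_dist_sign (mu nu : X -> R) : exists2 g : X -> R,
  forall x, `|g x| <= 1 & tv_dist mu nu = 2^-1 * \sum_x (mu x - nu x) * g x.
Proof.
exists (fun x => Num.sg (mu x - nu x)).
  by move=> x; rewrite normr_sg lern1 leq_b1.
by rewrite /tv_dist; congr (_ * _); apply: eq_bigr => x _; rewrite normrEsg mulrC.
Qed.

Definition log_density t o y : R := ln (heat C t o y / pi y).

(* The reverse Pinsker step (mean of [h] is at most [ln (2 / eps) + delta]) and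
   the truncation of the density at [expR M] both rest on the Chebyshev bound
   [\sum_y w y * ((h y - m) / delta) ^+ 2 <= eps / 2]. *)
Lemma tv_dist_heat_varentropy t o (sigma eps : R) :
  0 < t -> 0 < sigma -> 0 < eps -> eps <= 1 ->
  heat_op C t (fun y => log_density t o y ^+ 2) o
    - heat_op C t (log_density t o) o ^+ 2 <= sigma ^+ 2 ->
  tv_dist (heat C t o) pi <= 1 - eps ->
  tv_dist (heat C (t + 2 * t_rel C pi / eps ^+ 2 * (1 + sigma)) o) pi <= eps.
Proof.
move=> t0 sigma0 eps0 eps1; set h := log_density t o => var_h tv_t.
set T := t_rel C pi; set s := 2 * T / eps ^+ 2 * (1 + sigma).
have [pi_ge0 pi1 _] := pi_stat; have pi0 := stationary_gt0 pi_stat.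
have T0 : 0 < T := t_rel_gt0 pi_stat.
pose w := heat C t o.
have w0 y : 0 < w y.
  by apply: heat_gt0 => //; exact: chain_irreducible.
have w1 : \sum_y w y = 1 by exact: heat_sum1.
have wE y : w y = pi y * expR (h y).
  by rewrite /h /log_density lnK ?posrE ?divr_gt0 ?w0// mulrC divfK// gt_eqF.
pose delta := sigma * Num.sqrt (2 / eps).
have delta0 : 0 < delta by rewrite mulr_gt0// sqrtr_gt0 divr_gt0.
have deltaE : delta ^+ 2 = sigma ^+ 2 * (2 / eps).
  by rewrite exprMn sqr_sqrtr// divr_ge0// ltW.
(* [q] dominates [w] where [h] is farther than [delta] from its mean, so its sum stands in for the
   mass of the exceptional sets. *)
pose m := heat_op C t h o; pose q y := w y * ((h y - m) / delta) ^+ 2.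
have q_ge0 y : 0 <= q y by rewrite mulr_ge0 ?sqr_ge0// ltW.
have q_sum : \sum_y q y <= eps / 2.
  have -> : \sum_y q y = (\sum_y w y * (h y - m) ^+ 2) / delta ^+ 2.
    by rewrite mulr_suml; apply: eq_bigr => y _; rewrite /q expr_div_n mulrA.
  have -> : \sum_y w y * (h y - m) ^+ 2 =
      heat_op C t (fun y => h y ^+ 2) o - heat_op C t h o ^+ 2.
    have key c : \sum_y w y * (h y - c) ^+ 2 = heat_op C t (fun y => h y ^+ 2) o
        - 2 * c * heat_op C t h o + c ^+ 2 * \sum_y w y.
      rewrite /heat_op !mulr_sumr -sumrB -big_split /=.
      by apply: eq_bigr => y _; rewrite -/w; ring.
    by rewrite key w1 -/m; ring.
  rewrite ler_pdivrMr ?exprn_gt0// deltaE.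
  by rewrite (_ : eps / 2 * _ = sigma ^+ 2)//; field; rewrite gt_eqF.
have q_ge1 y : delta < `|h y - m| -> w y <= q y.
  move=> dh; rewrite /q ler_peMr ?(ltW (w0 y))// expr_div_n ler_pdivlMr ?exprn_gt0//.
  by rewrite mul1r -[leRHS]real_normK ?num_real// lerXn2r ?nnegrE// ltW.
(* Where [h >= m - delta], [pi] is at most [exp (delta - m) w]; elsewhere [w <= q]. The overlap of
   [w] and [pi] is thus at most [eps / 2 + exp (delta - m)], while the total variation bound makes
   it at least [eps]. *)
have m_le : m <= ln (2 / eps) + delta.
  have minq y : Num.min (w y) (pi y) <= q y + w y * expR (delta - m).
    have [hd|hd] := ltP (h y) (m - delta).
      apply: (@le_trans _ _ (w y)); first by rewrite ge_min lexx.
      rewrite -[leLHS]addr0; apply: lerD.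
        by apply: q_ge1; rewrite distrC ltr_normr; apply/orP; left; lra.
      exact: mulr_ge0 (ltW (w0 y)) (expR_ge0 _).
    apply: (@le_trans _ _ (pi y)); first by rewrite ge_min lexx orbT.
    rewrite -[leLHS]add0r; apply: lerD; first exact: q_ge0.
    rewrite wE -mulrA -expRD; apply: ler_peMr; first exact: pi_ge0.
    by rewrite -[leLHS]expR0 ler_expR; lra.
  have : \sum_y Num.min (w y) (pi y) <= \sum_y (q y + w y * expR (delta - m)).
    exact: ler_sum.
  rewrite big_split /= -mulr_suml w1 mul1r => hsum.
  move: tv_t; rewrite tv_distE// -/w => tv_t.
  have : eps / 2 <= expR (delta - m) by lra.
  rewrite -ler_ln ?posrE ?expR_gt0 ?divr_gt0// expRK.
  rewrite -invf_div lnV ?posrE ?divr_gt0//; lra.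
pose M := ln (2 / eps) + 2 * delta.
(* Equivalent to [exp M * exp (- 2 s / T) <= eps ^ 2]: time [s] suffices to relax a density bounded
   by [exp M]. It follows from [ln x <= x - 1] and [sqrt (2 / eps) <= 2 / eps]. *)
have sM : M / 2 + ln eps^-1 <= s / T.
  have e2 : 1 <= eps^-1 by rewrite invf_ge1.
  have le_sqrt : Num.sqrt (2 / eps) <= 2 / eps.
    have : 1 <= Num.sqrt (2 / eps) by rewrite -[leLHS]sqrtr1 ler_wsqrtr//; lra.
    by move=> ?; rewrite -[leRHS](@sqr_sqrtr _ (2 / eps)) ?expr2 ?ler_peMr//; lra.
  have -> : s / T = 2 * eps^-1 * eps^-1 * (1 + sigma).
    by rewrite /s; field; rewrite !gt_eqF.
  have ln_le (x : R) : 0 < x -> ln x <= x - 1.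
    by move=> x0; rewrite -[x in leLHS](subrKC 1) le_ln1Dx//; lra.
  have l1 : ln eps^-1 <= eps^-1 - 1 by apply: ln_le; lra.
  have l2 : ln (2 / eps) <= 2 / eps - 1 by apply: ln_le; lra.
  have e3 : eps^-1 <= eps^-1 * eps^-1 by rewrite ler_peMr//; lra.
  have d1 : delta <= sigma * (2 / eps) by rewrite ler_wpM2l// ltW.
  have d2 : sigma * eps^-1 <= sigma * (eps^-1 * eps^-1) by rewrite ler_wpM2l// ltW.
  rewrite /M; lra.
have s0 : 0 <= s by rewrite mulr_ge0 ?divr_ge0 ?mulr_ge0 ?sqr_ge0 ?addr_ge0// ltW.
have [g g1 ->] := tv_dist_sign (heat C (t + s) o) pi.
pose G := heat_op C s g; pose gam := mean pi g.
have bnd (v : X -> R) : (forall y, 0 <= v y) -> \sum_y v y = 1 ->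
    `|\sum_y v y * g y| <= 1.
  move=> v0 v1; apply: le_trans (ler_norm_sum _ _ _) _; rewrite -v1.
  by apply: ler_sum => y _; rewrite normrM ger0_norm// ler_piMr.
have G1 y : `|G y| <= 1.
  by apply: bnd; [move=> z; exact: heat_ge0|exact: heat_sum1].
have gam1 : `|gam| <= 1.
  by rewrite /gam /mean; under eq_bigr do rewrite mulrC; exact: bnd.
have varG : variance pi G <= expR (- (2 * s / T)).
  have := variance_heat_op C_ge0 C_sum1 pi_stat g T0 (poincare_t_rel pi_stat) s0.
  move=> /le_trans; apply; rewrite ler_piMr ?expR_ge0//.
  apply: le_trans (variance_le pi_stat g 0) _; rewrite /mean -pi1.
  apply: ler_sum => y _; rewrite subr0 ler_piMl//.
  by rewrite -real_normK ?num_real// expr_le1.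
have -> : \sum_x (heat C (t + s) o x - pi x) * g x = \sum_y w y * (G y - gam).
  transitivity (heat_op C (t + s) g o - gam).
    rewrite /heat_op /gam /mean -sumrB; apply: eq_bigr => x _; ring.
  rewrite -heat_opD//; under [RHS]eq_bigr do rewrite mulrBr.
  by rewrite sumrB -mulr_suml w1 mul1r.
(* Where [h <= M], use [x <= eps / 2 + x ^ 2 / (2 eps)] and bound the density by [exp M] in the
   quadratic term only. Elsewhere [w <= q], because [M] is at least [m + delta], and [G - gam] is at
   most 2. *)
have pointwise y : w y * (G y - gam) <= 2^-1 * eps * w y
    + 2^-1 * (expR M / eps) * ((G y - gam) ^+ 2 * pi y) + 2 * q y.
  have half0 : 0 <= 2^-1 :> R by rewrite invr_ge0.
  have a0 : 0 <= 2^-1 * eps * w y.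
    exact: mulr_ge0 (mulr_ge0 half0 (ltW eps0)) (ltW (w0 y)).
  have b0 : 0 <= 2^-1 * (expR M / eps) * ((G y - gam) ^+ 2 * pi y).
    exact: mulr_ge0 (mulr_ge0 half0 (divr_ge0 (expR_ge0 _) (ltW eps0)))
      (mulr_ge0 (sqr_ge0 _) (pi_ge0 y)).
  have [hM|hM] := leP (h y) M.
    rewrite -[leLHS]addr0; apply: lerD; last exact: mulr_ge0.
    set x := G y - gam.
    have f0 := expR_gt0 (h y).
    have fM : expR (h y) <= expR M by rewrite ler_expR.
    have amgm : x <= 2^-1 * eps + 2^-1 * (x ^+ 2 / eps).
      rewrite -(ler_pM2r (_ : 0 < 2 * eps)) ?mulr_gt0//.
      have -> : (2^-1 * eps + 2^-1 * (x ^+ 2 / eps)) * (2 * eps) =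
        eps ^+ 2 + x ^+ 2 by field; rewrite gt_eqF.
      by have := sqr_ge0 (x - eps); lra.
    rewrite wE; have -> : pi y * expR (h y) * x = pi y * (expR (h y) * x) by ring.
    have -> : 2^-1 * eps * (pi y * expR (h y))
        + 2^-1 * (expR M / eps) * (x ^+ 2 * pi y) =
      pi y * (expR (h y) * (2^-1 * eps) + expR M * (2^-1 * (x ^+ 2 / eps))) by ring.
    rewrite ler_pM2l//; apply: (@le_trans _ _
      (expR (h y) * (2^-1 * eps + 2^-1 * (x ^+ 2 / eps)))).
      by rewrite ler_pM2l.
    rewrite mulrDr lerD2l ler_wpM2r// mulr_ge0 ?invr_ge0// divr_ge0 ?sqr_ge0//.
    exact: ltW.
  have wq : w y <= q y.
    apply: q_ge1; rewrite ltr_normr; apply/orP; left; rewrite /M in hM; lra.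
  have : w y * (G y - gam) <= w y * 2.
    rewrite ler_pM2l//; have := G1 y; have := gam1.
    by rewrite !ler_norml => /andP[? ?] /andP[? ?]; lra.
  lra.
have : \sum_y w y * (G y - gam) <= 2^-1 * eps
    + 2^-1 * (expR M / eps) * variance pi G + 2 * \sum_y q y.
  apply: (@le_trans _ _ (\sum_y (2^-1 * eps * w y
      + 2^-1 * (expR M / eps) * ((G y - gam) ^+ 2 * pi y) + 2 * q y))).
    exact: ler_sum.
  have split3 (a b c : R) (u v r : X -> R) :
      \sum_y (a * u y + b * v y + c * r y)
      = a * (\sum_y u y) + b * (\sum_y v y) + c * \sum_y r y.
    by rewrite !mulr_sumr -!big_split.
  rewrite split3 w1 mulr1.
  by rewrite /variance (mean_heat_op C_ge0 C_sum1 pi_stat g s0).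
(* The three contributions are then at most [eps / 2], [eps / 2] and [eps]; the factor [1 / 2] in
   [tv_dist] brings their sum down to [eps]. *)
have : expR M / eps * variance pi G <= eps.
  apply: (@le_trans _ _ (expR M / eps * expR (- (2 * s / T)))).
    by rewrite ler_wpM2l// divr_ge0 ?expR_ge0// ltW.
  rewrite mulrAC -expRD ler_pdivrMr//.
  have -> : eps * eps = expR (- (2 * ln eps^-1)).
    by rewrite lnV ?posrE// mulrN opprK mulr_natl mulr2n expRD lnK.
  by rewrite ler_expR -mulrA; lra.
lra.
Qed.

Hypothesis BE0 : (0%:E <= BE C)%E.

(** The edge bound [c] on the increments of [h] gives [Gamma h <= c ^ 2 / 2], and the local Poincare
    inequality multiplies this by [2 t]. *)
Lemma varentropy_heat t o : 0 < t ->
  (chain_diam C)%:R <= ((chain_k C)%:R + 3) * t ->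
  heat_op C t (fun y => log_density t o y ^+ 2) o
    - heat_op C t (log_density t o) o ^+ 2
    <= (3 * (chain_k C)%:R ^+ 2 * (ln (chain_Delta C) + 4) * Num.sqrt t) ^+ 2.
Proof.
move=> t0 diam_t; set h := log_density t o; set c := _ * (_ + 4).
have curv f x := BE_ge0_curvature C_ge0 f x BE0.
apply: le_trans (local_poincare C_ge0 C_sum1 curv h o (ltW t0)) _.
have Gh y : Gamma C h y <= 2^-1 * c ^+ 2.
  rewrite ler_wpM2l ?invr_ge0//.
  rewrite -[leRHS]mulr1 -(C_sum1 y) mulr_sumr; apply: ler_sum => z _.
  have [Cyz|] := ltP 0 (C y z); last first.
    move=> Cyz; have -> : C y z = 0 by apply/le_anti; rewrite Cyz C_ge0.
    by rewrite !mulr0.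
  rewrite ler_pM2r// -expr2 -[leLHS]real_normK ?num_real//.
  have hc : `|h y - h z| <= c by exact: log_density_lipschitz.
  by rewrite lerXn2r ?nnegrE// (le_trans _ hc).
have := le_heat_op C_ge0 C_sum1 o (ltW t0) Gh.
rewrite heat_op_cst// [(c * _) ^+ 2]exprMn sqr_sqrtr ?(ltW t0)// => hG.
by have := ler_wpM2l (ltW t0) hG; lra.
Qed.

End mixing.

(** * Passage to the infimum in the mixing time *)

Theorem proposition2p8 (R : realType) (X : finType)
    (C : irreducible_chain R X) (pi : X -> R) (hpi : is_stationary C pi)
    (hBE : (0%:E <= BE C)%E)
    (eps : R) (heps0 : 0 < eps) (heps1 : eps < 2^-1)
    (hdiam : (chain_diam C)%:R
             <= ((chain_k C)%:R + 3) * t_mix C pi (1 - eps)) :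
  t_mix C pi eps - t_mix C pi (1 - eps)
    <= 2 * t_rel C pi / eps ^+ 2
       * (1 + 3 * (chain_k C)%:R ^+ 2 * (ln (chain_Delta C) + 4)
              * Num.sqrt (t_mix C pi (1 - eps))).
Proof.
have D1 : 1 <= (chain_diam C)%:R :> R by rewrite ler1n chain_diam_gt0.
have k1 : 1 <= (chain_k C)%:R :> R by rewrite ler1n chain_k_gt0.
have L0 := ln_chain_Delta_ge0 C; have T0 := t_rel_gt0 hpi.
set c := 3 * _ * _.
have c0 : 0 < c.
  by rewrite /c mulr_gt0 ?mulr_gt0 ?exprn_gt0//; lra.
set q := 2 * _ / _.
have q0 : 0 < q by rewrite /q divr_gt0 ?mulr_gt0 ?exprn_gt0.
set t0 := t_mix C pi (1 - eps) in hdiam *.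
have K0 : 0 < (chain_k C)%:R + 3 :> R by lra.
have t0_gt0 : 0 < t0.
  by rewrite -(pmulr_rgt0 _ K0); exact: lt_le_trans (lt_le_trans ltr01 D1) hdiam.
pose S e := [set t : R | 0 <= t /\
  \big[Num.max/0]_(x : X) tv_dist (heat C t x) pi <= e].
have lbS e : has_lbound (S e) by exists 0 => t [].
(* The infimum of the empty set is 0 by default, whereas [t0] is positive because the diameter is at
   least 1. *)
have S0 : S (1 - eps) !=set0.
  apply/set0P/eqP => S0; move: t0_gt0.
  by rewrite /t0 /t_mix -/(S (1 - eps)) S0 inf0 ltxx.
(* The infimum [t0] is not known to be attained, so the bound is first proved at every time [t] of
   the set. *)
have step t : S (1 - eps) t -> t_mix C pi eps <= t + q * (1 + c * Num.sqrt t).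
  move=> St; have t0t : t0 <= t by exact: (ge_inf (lbS _) St).
  have t_gt0 : 0 < t by exact: lt_le_trans t0t.
  have diam_t : (chain_diam C)%:R <= ((chain_k C)%:R + 3) * t.
    by apply: le_trans hdiam _; rewrite ler_pM2l.
  have sig0 : 0 < c * Num.sqrt t by rewrite mulr_gt0 ?sqrtr_gt0.
  apply: (ge_inf (lbS eps)); split.
    exact: addr_ge0 (ltW t_gt0) (mulr_ge0 (ltW q0) (addr_ge0 ler01 (ltW sig0))).
  apply: bigmax_le => [|o _]; first exact: ltW.
  apply: tv_dist_heat_varentropy => //.
  - lra.
  - exact: varentropy_heat.
  by case: St => _; apply: le_trans; exact: (@le_bigmax _ _ _ _ _ o).
rewrite lerBlDl; apply/ler_addgt0Pr => eta eta0.
have r1 : 0 < 1 + q * c by rewrite ltr_pwDl// mulr_ge0 ?ltW.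
(* For [t < t0 + r ^ 2] one has [sqrt t <= sqrt t0 + r], and [r <= 1] gives [r ^ 2 <= r]; the total
   excess is at most [r * (1 + q * c) <= eta]. *)
pose r := Num.min 1 (eta / (1 + q * c)).
have r0 : 0 < r by rewrite lt_min ltr01 divr_gt0.
have [t St tr] : exists2 t, S (1 - eps) t & t < t0 + r ^+ 2.
  apply: inf_adherent; last by split.
  exact: exprn_gt0.
apply: le_trans (step t St) _.
have sq : Num.sqrt t <= Num.sqrt t0 + r.
  have sr0 : 0 <= Num.sqrt t0 + r by rewrite addr_ge0 ?sqrtr_ge0// ltW.
  rewrite -[leRHS]ger0_norm// -sqrtr_sqr ler_wsqrtr//.
  apply: (le_trans (ltW tr)); rewrite sqrrD sqr_sqrtr ?(ltW t0_gt0)//.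
  by rewrite lerD2r lerDl mulrn_wge0// mulr_ge0 ?sqrtr_ge0// ltW.
have := ler_wpM2l (mulr_ge0 (ltW q0) (ltW c0)) sq.
have : r ^+ 2 <= r.
  by rewrite expr2 ler_piMl ?(ltW r0)// ge_min lexx.
have : r * (1 + q * c) <= eta by rewrite -ler_pdivlMr// ge_min lexx orbT.
lra.
Qed.
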